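(* Let $u_i\in\mathcal{U}$ be an actuator, let $\delta_r(u_i)$ be its robust security index (the optimal value of the robust security index problem for $u_i$), and let $\delta^*$ be the optimal value of the minimum $u_i$--$t$ cut problem in the weighted directed graph $\mathcal{G}_{u_i}$. If the robust security index problem for $u_i$ is solvable (feasible), then $\delta_r(u_i)=\delta^*+1$. Otherwise, $\delta_r(u_i)=\delta^*=+\infty$.
   Context: Structural model. $[A]\in\{0,1\}^{n_x\times n_x}$, $[B]\in\{0,1\}^{n_x\times n_u}$, $[C]\in\{0,1\}^{(n_y+n_e)\times n_x}$ with $[B]=[e_{i_1}\cdots e_{i_{n_u}}]$ of full column rank and $[C]=[e_{j_1}\cdots e_{j_{n_y+n_e}}]^T$, where $e_i$ are canonical basis vectors (each actuator influences one state, distinct actuators distinct states; each sensor measures one state). Graph. $\mathcal{X}=\{x_1,\dots,x_{n_x}\}$ (states), $\mathcal{U}=\{u_1,\dots,u_{n_u}\}$ (actuators), $\mathcal{Y}=\{y_1,\dots,y_{n_y+n_e}\}$ (sensors; $y_1,\dots,y_{n_y}$ unprotected, the last $n_e\ge0$ protected). $\mathcal{E}_{ux}=\{(u_j,x_i):[B](i,j)\ne0\}$, $\mathcal{E}_{xx}=\{(x_j,x_i):[A](i,j)\neq0\}$, $\mathcal{E}_{xy}=\{(x_j,y_i):[C](i,j)\ne0\}$. The extended graph $\mathcal{G}_t$ is the directed graph with nodes $\mathcal{X}\cup\mathcal{U}\cup\mathcal{Y}\cup\{t\}$ and edges $\mathcal{E}_{ux}\cup\mathcal{E}_{xx}\cup\mathcal{E}_{xy}\cup\{(y_i,t):y_i\in\mathcal{Y}\}$.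 Two nodes are adjacent if there is an edge between them. A vertex separator of non-adjacent nodes $v_a,v_b$ is a set of nodes not containing $v_a,v_b$ whose removal deletes all directed paths from $v_a$ to $v_b$. Robust security index problem for $u_i$. Minimize $|\mathcal{U}_a|+|\mathcal{Y}_a|$ over $\mathcal{U}_a\subseteq\mathcal{U}$, $\mathcal{Y}_a\subseteq\mathcal{Y}$ such that $u_i\in\mathcal{U}_a$, all sensors in $\mathcal{Y}_a$ are unprotected, and $\mathcal{X}_a\cup\mathcal{Y}_a$ is a vertex separator of $u_i$ and $t$ in $\mathcal{G}_t$, where $\mathcal{X}_a=\{x_j\in\mathcal{X}:(u_k,x_j)\in\mathcal{E}_{ux},\ u_k\in\mathcal{U}_a\setminus\{u_i\}\}$. The optimal value is $\delta_r(u_i)$; if infeasible, $\delta_r(u_i)=+\infty$. The weighted graph $\mathcal{G}_{u_i}$. A state $x_j$ is of Type 1 if it is adjacent to some actuator in $\mathcal{U}\setminus\{u_i\}$, and of Type 2 otherwise. Nodes of $\mathcal{G}_{u_i}$: $u_i$ and $t$; two nodes $x_{j_{in}},x_{j_{out}}$ for each Type 1 state $x_j$; one node $x_j$ for each Type 2 state $x_j$. Edges and weights: (1) if $(u_i,x_j)\in\mathcal{E}_{ux}$, the edge $(u_i,x_j)$ with weight $+\infty$; (2) for each $(x_j,x_k)\in\mathcal{E}_{xx}$ with $x_j\neq x_k$, an edge of weight $+\infty$, namely $(x_{j_{out}},x_{k_{in}})$ if both are Type 1; $(x_{j_{out}},x_k)$ if $x_j$ is Type 1 and $x_k$ Type 2;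 $(x_j,x_{k_{in}})$ if $x_j$ is Type 2 and $x_k$ Type 1; $(x_j,x_k)$ if both are Type 2; (3) for each Type 1 state $x_j$, the edge $(x_{j_{in}},x_{j_{out}})$ with weight $1$; (4) for each state $x_j$ that is measured by at least one sensor, the edge $(x_{j_{out}},t)$ if $x_j$ is Type 1, or $(x_j,t)$ if Type 2; its weight is $+\infty$ if any sensor measuring $x_j$ is protected, and otherwise the number of (unprotected) sensors measuring $x_j$. Minimum $s$--$t$ cut problem. In a directed graph with node set $\mathcal{V}$, edge set $\mathcal{E}$ and edge weights $w$, minimize $C(\mathcal{V}_s)=\sum_{(v,v')\in\mathcal{E}:\,v\in\mathcal{V}_s,\,v'\in\mathcal{V}\setminus\mathcal{V}_s}w_{vv'}$ over $\mathcal{V}_s\subseteq\mathcal{V}$ with $s\in\mathcal{V}_s$, $t\notin\mathcal{V}_s$. Here $s=u_i$. *)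

(* Defs.v *)
From HB Require Import structures.
From mathcomp Require Import all_boot all_order all_algebra.
From mathcomp Require Import constructive_ereal.

Set Implicit Arguments.
Unset Strict Implicit.
Unset Printing Implicit Defensive.

Import Order.TTheory GRing.Theory Num.Theory.
Local Open Scope ring_scope.

Definition adjacent (V : finType) (e : rel V) (v w : V) : bool :=
  e v w || e w v.

Definition remove_nodes (V : finType) (e : rel V) (S : {set V}) : rel V :=
  fun v w => [&& v \notin S, w \notin S & e v w].

Definition vertex_separator (V : finType) (e : rel V) (a b : V) (S : {set V})
    : bool :=
  [&& ~~ adjacent e a b, a \notin S, b \notin S
    & ~~ connect (remove_nodes e S) a b].

Definition cut_value (R : realDomainType) (V : finType) (e : rel V)
    (w : V -> V -> \bar R) (Vs : {set V}) : \bar R :=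
  (\sum_(p : V * V | [&& e p.1 p.2, p.1 \in Vs & p.2 \notin Vs]) w p.1 p.2)%E.

Definition min_cut (R : realDomainType) (V : finType) (e : rel V)
    (w : V -> V -> \bar R) (s t : V) : \bar R :=
  \big[Order.min/+oo%E]_(Vs : {set V} | (s \in Vs) && (t \notin Vs))
    cut_value e w Vs.

(* The rank of the 0/1 matrix [B] is taken over the rationals.
   Sensors are indexed by 'I_(ny + ne), the last ne of them being protected. *)
Record structural_model (nx nu ny ne : nat) := StructuralModel {
  strA : 'M[rat]_nx;
  strB : 'M[rat]_(nx, nu);
  strC : 'M[rat]_(ny + ne, nx);
  strA01 : forall i j, strA i j = 0 \/ strA i j = 1;
  strB_canonical : forall j, exists i, col j strB = delta_mx i 0;
  strB_full_rank : \rank strB = nu;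
  strC_canonical : forall i, exists j, row i strC = delta_mx 0 j
}.

Inductive Gt_node (nx nu ns : nat) :=
  | State of 'I_nx
  | Actuator of 'I_nu
  | Sensor of 'I_ns
  | Sink.
Arguments State {nx nu ns}.
Arguments Actuator {nx nu ns}.
Arguments Sensor {nx nu ns}.
Arguments Sink {nx nu ns}.

Definition Gt_node_encode (nx nu ns : nat) (v : Gt_node nx nu ns) :
    'I_nx + ('I_nu + ('I_ns + unit)) :=
  match v with
  | State j => inl j
  | Actuator k => inr (inl k)
  | Sensor i => inr (inr (inl i))
  | Sink => inr (inr (inr tt))
  end.

Definition Gt_node_decode (nx nu ns : nat)
    (c : 'I_nx + ('I_nu + ('I_ns + unit))) : Gt_node nx nu ns :=
  match c with
  | inl j => State j
  | inr (inl k) => Actuator k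
  | inr (inr (inl i)) => Sensor i
  | inr (inr (inr _)) => Sink
  end.

Lemma Gt_node_encodeK (nx nu ns : nat) :
  cancel (@Gt_node_encode nx nu ns) (@Gt_node_decode nx nu ns).
Proof. by case. Qed.

HB.instance Definition _ (nx nu ns : nat) :=
  Finite.copy (Gt_node nx nu ns) (can_type (@Gt_node_encodeK nx nu ns)).

(* [M](i, j) <> 0 encodes an edge from the node of column j to that of row i. *)
Definition Gt_edge (nx nu ny ne : nat) (M : structural_model nx nu ny ne) :
    rel (Gt_node nx nu (ny + ne)) :=
  fun v w =>
    match v, w with
    | Actuator j, State i => strB M i j != 0
    | State j, State i => strA M i j != 0
    | State j, Sensor i => strC M i j != 0
    | Sensor _, Sink => true
    | _, _ => false
    end.

Definition protected (ny ne : nat) (i : 'I_(ny + ne)) : bool := (ny <= i)%N.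

Definition attacked_nodes (nx nu ny ne : nat) (M : structural_model nx nu ny ne)
    (ui : 'I_nu) (Ua : {set 'I_nu}) (Ya : {set 'I_(ny + ne)}) :
    {set Gt_node nx nu (ny + ne)} :=
  [set State j | j : 'I_nx &
     [exists k in Ua :\ ui, Gt_edge M (Actuator k) (State j)]]
  :|: [set Sensor i | i in Ya].

Definition robust_feasible (nx nu ny ne : nat)
    (M : structural_model nx nu ny ne) (ui : 'I_nu)
    (Ua : {set 'I_nu}) (Ya : {set 'I_(ny + ne)}) : bool :=
  [&& ui \in Ua,
      [forall i in Ya, ~~ protected i]
    & vertex_separator (Gt_edge M) (Actuator ui) Sink
        (attacked_nodes M ui Ua Ya)].

Definition robust_solvable (nx nu ny ne : nat)
    (M : structural_model nx nu ny ne) (ui : 'I_nu) : Prop :=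
  exists (Ua : {set 'I_nu}) (Ya : {set 'I_(ny + ne)}),
    robust_feasible M ui Ua Ya.

(* The default +oo of the iterated minimum is the value when infeasible. *)
Definition robust_security_index (nx nu ny ne : nat)
    (M : structural_model nx nu ny ne) (ui : 'I_nu) : \bar int :=
  \big[Order.min/+oo%E]_(a : {set 'I_nu} * {set 'I_(ny + ne)}
                          | robust_feasible M ui a.1 a.2)
    ((#|a.1| + #|a.2|)%N%:Z)%:E.

Definition type1 (nx nu ny ne : nat) (M : structural_model nx nu ny ne)
    (ui : 'I_nu) (j : 'I_nx) : bool :=
  [exists k : 'I_nu,
     (k != ui) && adjacent (Gt_edge M) (State j) (Actuator k)].

Inductive Gu_node (nx nu ny ne : nat) (M : structural_model nx nu ny ne)
    (ui : 'I_nu) :=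
  | GuSource
  | GuSink
  | GuIn of {j : 'I_nx | type1 M ui j}
  | GuOut of {j : 'I_nx | type1 M ui j}
  | GuState of {j : 'I_nx | ~~ type1 M ui j}.
Arguments GuSource {nx nu ny ne M ui}.
Arguments GuSink {nx nu ny ne M ui}.
Arguments GuIn {nx nu ny ne M ui}.
Arguments GuOut {nx nu ny ne M ui}.
Arguments GuState {nx nu ny ne M ui}.

Definition Gu_node_encode (nx nu ny ne : nat) (M : structural_model nx nu ny ne)
    (ui : 'I_nu) (v : Gu_node M ui) :
    bool + (bool * {j : 'I_nx | type1 M ui j} + {j : 'I_nx | ~~ type1 M ui j}) :=
  match v with
  | GuSource => inl true
  | GuSink => inl false
  | GuIn x => inr (inl (true, x))
  | GuOut x => inr (inl (false, x))
  | GuState x => inr (inr x)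
  end.

Definition Gu_node_decode (nx nu ny ne : nat) (M : structural_model nx nu ny ne)
    (ui : 'I_nu)
    (c : bool + (bool * {j : 'I_nx | type1 M ui j}
                 + {j : 'I_nx | ~~ type1 M ui j})) : Gu_node M ui :=
  match c with
  | inl true => GuSource
  | inl false => GuSink
  | inr (inl (true, x)) => GuIn x
  | inr (inl (false, x)) => GuOut x
  | inr (inr x) => GuState x
  end.

Lemma Gu_node_encodeK (nx nu ny ne : nat) (M : structural_model nx nu ny ne)
    (ui : 'I_nu) :
  cancel (@Gu_node_encode nx nu ny ne M ui) (@Gu_node_decode nx nu ny ne M ui).
Proof. by case. Qed.

HB.instance Definition _ (nx nu ny ne : nat) (M : structural_model nx nu ny ne)
    (ui : 'I_nu) :=
  Finite.copy (Gu_node M ui) (can_type (@Gu_node_encodeK nx nu ny ne M ui)).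

Definition Exx_neq (nx nu ny ne : nat) (M : structural_model nx nu ny ne)
    (j k : 'I_nx) : bool :=
  Gt_edge M (State j) (State k) && (j != k).

Definition measuring_sensors (nx nu ny ne : nat)
    (M : structural_model nx nu ny ne) (j : 'I_nx) : {set 'I_(ny + ne)} :=
  [set i | Gt_edge M (State j) (Sensor i)].

(* Distinct actuators influence distinct states, so the state driven by ui is
   of Type 2 and the only edge leaving GuSource ends in a GuState node. *)
Definition Gu_edge (nx nu ny ne : nat) (M : structural_model nx nu ny ne)
    (ui : 'I_nu) : rel (Gu_node M ui) :=
  fun v w =>
    match v, w with
    | GuSource, GuState x => Gt_edge M (Actuator ui) (State (val x))
    | GuOut x, GuIn y => Exx_neq M (val x) (val y)
    | GuOut x, GuState y => Exx_neq M (val x) (val y)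
    | GuState x, GuIn y => Exx_neq M (val x) (val y)
    | GuState x, GuState y => Exx_neq M (val x) (val y)
    | GuIn x, GuOut y => x == y
    | GuOut x, GuSink => measuring_sensors M (val x) != set0
    | GuState x, GuSink => measuring_sensors M (val x) != set0
    | _, _ => false
    end.

Definition sensor_weight (nx nu ny ne : nat) (M : structural_model nx nu ny ne)
    (j : 'I_nx) : \bar int :=
  if [exists i in measuring_sensors M j, protected i] then +oo%E
  else (#|measuring_sensors M j|%:Z)%:E.

(* Only the values on edges are relevant. *)
Definition Gu_weight (nx nu ny ne : nat) (M : structural_model nx nu ny ne)
    (ui : 'I_nu) (v w : Gu_node M ui) : \bar int :=
  match v, w with
  | GuIn _, GuOut _ => 1%E
  | GuOut x, GuSink => sensor_weight M (val x)
  | GuState x, GuSink => sensor_weight M (val x)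
  | _, _ => +oo%E
  end.

(* Main.v *)
(* An attack (U_a, Y_a) and a finite cut of G_ui are two descriptions of the
   same set of components: the edge x_in -> x_out is charged to the unique
   actuator other than u_i driving x, and an edge into t to the sensors
   measuring its tail, so a finite cut costs exactly the number of components
   charged to its edges.  Given a feasible attack, put on the source side the
   exit nodes of the states still reachable from u_i, and also the entry nodes
   of the attacked states: every cut edge is then charged to attacked
   components.  Conversely, the components charged to a finite cut, together
   with u_i, form a feasible attack, since an unattacked path from u_i can never
   leave the states whose exit node is on the source side.  The "+ 1" is u_i
   itself, and with +oo + 1 = +oo the equality also covers infeasibility. *)

Require Import Defs.
From mathcomp Require Import all_boot all_order all_algebra.
From mathcomp Require Import constructive_ereal.

Set Implicit Arguments.
Unset Strict Implicit.
Unset Printing Implicit Defensive.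

Import Order.TTheory GRing.Theory Num.Theory.

Section StructuralModel.

Context {nx nu ny ne : nat} (M : structural_model nx nu ny ne).

(** * Uniqueness of drivers, driven states and measured states *)

Lemma strB_row_uniq i i' k :
  (strB M i k != 0)%R -> (strB M i' k != 0)%R -> i = i'.
Proof.
have [i0 colk] := strB_canonical M k.
have entry j : strB M j k = ((j == i0)%:R)%R.
  by move/matrixP/(_ j ord0): colk; rewrite !mxE eqxx andbT.
by rewrite !entry; case: (i =P i0) => [->|_]; case: (i' =P i0); rewrite ?eqxx.
Qed.

(** Full column rank makes the rows of the transpose free, so two actuators sharing a canonical
    column coincide. *)
Lemma strB_col_uniq i k k' :
  (strB M i k != 0)%R -> (strB M i k' != 0)%R -> k = k'.
Proof.
have colE j : (strB M i j != 0)%R -> col j (strB M) = delta_mx i 0%R.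
  have [i0 colj] := strB_canonical M j.
  have := colj; move/matrixP/(_ i ord0); rewrite !mxE eqxx andbT => ->.
  by rewrite colj; case: (i =P i0) => [->|_]; rewrite ?eqxx.
move=> /colE Bk /colE Bk'.
have free : row_free (strB M)^T by rewrite /row_free mxrank_tr strB_full_rank.
have : (delta_mx 0%R k : 'rV[rat]_nu) = delta_mx 0%R k'.
  by apply: (row_free_inj free); rewrite -!rowE -!tr_col Bk Bk'.
move/matrixP/(_ 0%R k); rewrite !mxE !eqxx /=.
by case: (k =P k') => // _ /eqP; rewrite oner_eq0.
Qed.

Lemma strC_col_uniq i j j' :
  (strC M i j != 0)%R -> (strC M i j' != 0)%R -> j = j'.
Proof.
have [j0 rowi] := strC_canonical M i.
have entry l : strC M i l = ((l == j0)%:R)%R.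
  by move/matrixP/(_ ord0 l): rowi; rewrite !mxE eqxx.
by rewrite !entry; case: (j =P j0) => [->|_]; case: (j' =P j0); rewrite ?eqxx.
Qed.

Context (ui : 'I_nu).

Lemma type1P j :
  reflect (exists2 k, k != ui & (strB M j k != 0)%R) (type1 M ui j).
Proof.
apply: (iffP existsP) => [[k /andP[kui]]|[k kui Bjk]]; first by exists k.
by exists k; rewrite kui /adjacent /= Bjk.
Qed.

Lemma driven_type2 j : (strB M j ui != 0)%R -> ~~ type1 M ui j.
Proof.
move=> Bj; apply/type1P => -[k kui Bjk].
by rewrite (strB_col_uniq Bjk Bj) eqxx in kui.
Qed.

Lemma mem_attacked_state Ua Ya j :
  (State j \in attacked_nodes M ui Ua Ya) =
  [exists k in Ua :\ ui, strB M j k != 0%R].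
Proof.
rewrite in_setU; apply/orP/idP => [[/imsetP[l]|/imsetP[] //]|h]; last first.
  by left; apply/imsetP; exists j; rewrite // inE.
by rewrite inE => h [->].
Qed.

Lemma mem_attacked_sensor Ua Ya i :
  (Sensor i \in attacked_nodes M ui Ua Ya) = (i \in Ya).
Proof.
rewrite in_setU; apply/orP/idP => [[/imsetP[] //|/imsetP[l ? [->]] //]|h].
by right; apply/imsetP; exists i.
Qed.

Lemma actuator_unattacked Ua Ya k :
  Actuator k \notin attacked_nodes M ui Ua Ya.
Proof. by rewrite in_setU; apply/norP; split; apply/imsetP => -[]. Qed.

Lemma sink_unattacked Ua Ya : Sink \notin attacked_nodes M ui Ua Ya.
Proof. by rewrite in_setU; apply/norP; split; apply/imsetP => -[]. Qed.

(** * Charging edges to actuators and sensors *)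

Definition resource (v w : Gu_node M ui) (z : 'I_nu + 'I_(ny + ne)) : bool :=
  match z, v, w with
  | inl k, GuIn x, GuOut y =>
      [&& x == y, k != ui & Gt_edge M (Actuator k) (State (val x))]
  | inr i, GuOut x, GuSink | inr i, GuState x, GuSink =>
      Gt_edge M (State (val x)) (Sensor i)
  | _, _, _ => false
  end.

(** An actuator drives one state and a sensor measures one state, and a state cannot be of both
    types. Hence distinct edges are charged to disjoint sets, and cardinalities add up over a
    cut. *)
Lemma resource_inj z v w v' w' :
  resource v w z -> resource v' w' z -> (v, w) = (v', w').
Proof.
case: z v w v' w' => [k|i] [||x|x|x] // [||y|y|y] // [||x'|x'|x'] //
  [||y'|y'|y'] //=.
- case/and3P=> /eqP-> _ Bx /and3P[/eqP<- _ Bx'].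
  by have -> : y = x' by apply: val_inj; apply: strB_row_uniq Bx Bx'.
- by move=> Cx Cx'; rewrite (val_inj (strC_col_uniq Cx Cx')).
- move=> Cx Cx'; move: (valP x') (valP x).
  by rewrite /= (strC_col_uniq Cx Cx') => /negP.
- move=> Cx Cx'; move: (valP x') (valP x).
  by rewrite /= (strC_col_uniq Cx Cx') => ->.
- by move=> Cx Cx'; rewrite (val_inj (strC_col_uniq Cx Cx')).
Qed.

Lemma card_resource_sensor j (P : pred ('I_nu + 'I_(ny + ne))) :
  (forall k, P (inl k) = false) ->
  (forall i, P (inr i) = Gt_edge M (State j) (Sensor i)) ->
  #|P| = #|measuring_sensors M j|.
Proof.
move=> PL PR; rewrite -!sum1_card big_sumType /= big_pred0 ?add0n //.
by apply: eq_bigl => i; rewrite inE -PR.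
Qed.

(** The weight 1 is a count too: a Type 1 state has a driver other than [ui], and only one. *)
Lemma Gu_weight_resource v w :
  Gu_edge v w -> (Gu_weight v w != +oo)%E ->
  Gu_weight v w = (#|resource v w|%:Z)%:E%E.
Proof.
case: v w => [||x|x|x] [||y|y|y] //=.
- move=> /eqP<- _; congr (_%:E)%E.
  have /type1P[k kui Bk] := valP x.
  rewrite (_ : #|_| = 1) //.
  apply: (@eq_card1 _ (inl k)) => -[l|//]; rewrite !inE unfold_in /= eqxx /=.
  apply/andP/eqP => [[_ Bl]|[->] //].
  by congr inl; apply: strB_col_uniq Bl Bk.
- rewrite /sensor_weight; case: ifP => // _ _ _; congr (_%:Z%:E)%E.
  by apply/esym/card_resource_sensor.
- rewrite /sensor_weight; case: ifP => // _ _ _; congr (_%:Z%:E)%E.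
  by apply/esym/card_resource_sensor.
Qed.

Definition cut_edge (Vs : {set Gu_node M ui})
    (p : Gu_node M ui * Gu_node M ui) : bool :=
  [&& Gu_edge p.1 p.2, p.1 \in Vs & p.2 \notin Vs].

Definition cut_resources (Vs : {set Gu_node M ui}) :
    {set 'I_nu + 'I_(ny + ne)} :=
  [set z | [exists p, cut_edge Vs p && resource p.1 p.2 z]].

Lemma cut_value_card Vs :
  (forall p, cut_edge Vs p -> Gu_weight p.1 p.2 != +oo%E) ->
  cut_value (@Gu_edge _ _ _ _ M ui) (@Gu_weight _ _ _ _ M ui) Vs =
  (#|cut_resources Vs|%:Z)%:E%E.
Proof.
move=> fin; rewrite /cut_value.
rewrite (eq_bigr (fun p => (#|resource p.1 p.2|%:Z)%:E)%E); last first.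
  by move=> p cp; apply: Gu_weight_resource (fin p cp); case/and3P: cp.
rewrite sumEFin -(big_morph Posz PoszD (erefl (Posz 0))); congr (_%:Z%:E)%E.
(* [F p] is empty off the cut, so the disjoint union may range over all pairs. *)
pose F p := [set z | cut_edge Vs p && resource p.1 p.2 z].
have -> : cut_resources Vs = \bigcup_p F p.
  apply/setP=> z; rewrite inE; apply/existsP/bigcupP => [[p zp]|[p _]].
    by exists p; rewrite ?inE.
  by rewrite inE; exists p.
rewrite -sum1_card partition_disjoint_bigcup => [|p q pq]; last first.
  apply/pred0P=> z /=; apply/negP; rewrite !inE.
  move=> /andP[/andP[_ zp] /andP[_ zq]].
  case/eqP: pq; rewrite (surjective_pairing p) (resource_inj zp zq).
  by rewrite -surjective_pairing.
rewrite big_mkcond; apply: eq_bigr => p _; rewrite sum1_card /F.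
rewrite -/(cut_edge Vs p); case: ifP => cp.
  by apply: eq_card => z; rewrite inE.
by rewrite eq_card0 // => z; rewrite inE.
Qed.

(** No weight is [-oo], so a single infinite cut edge makes the whole sum infinite. *)
Lemma cut_finite Vs p :
  cut_value (@Gu_edge _ _ _ _ M ui) (@Gu_weight _ _ _ _ M ui) Vs != +oo%E ->
  cut_edge Vs p -> Gu_weight p.1 p.2 != +oo%E.
Proof.
move=> fin cp; apply: contra_neq fin => wp; apply/eqP.
rewrite /cut_value esum_eqy => [|q _].
  by apply/existsP; exists p; rewrite wp eqxx andbT.
case: q => [[||x|x|x] [||y|y|y]] //=; by rewrite /sensor_weight; case: ifP.
Qed.

Lemma card_attack (Ua : {set 'I_nu}) (Ya : {set 'I_(ny + ne)}) :
  ui \in Ua ->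
  #|Ua| + #|Ya| =
  #|[pred z | match z with inl k => k \in Ua :\ ui | inr i => i \in Ya end]|.+1.
Proof.
move=> uiU; rewrite (cardsD1 ui) uiU -addnA add1n; congr _.+1.
by rewrite -!sum1_card big_sumType /=.
Qed.

(** * From attacks to cuts *)

Lemma separator_cut Ua Ya : robust_feasible M ui Ua Ya ->
  exists Vs : {set Gu_node M ui},
    [/\ GuSource \in Vs, GuSink \notin Vs &
      cut_value (@Gu_edge _ _ _ _ M ui) (@Gu_weight _ _ _ _ M ui) Vs + 1
      <= ((#|Ua| + #|Ya|)%N%:Z)%:E]%E.
Proof.
case/and3P=> uiU /forall_inP unprot /and4P[_ _ _ sep].
set S := attacked_nodes M ui Ua Ya in sep.
pose reach j := connect (remove_nodes (Gt_edge M) S) (Actuator ui) (State j).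
have reachS j : reach j -> State j \notin S.
  case/connectP=> p; case/lastP: p => [//|p v]; rewrite rcons_path last_rcons.
  by case/andP=> _ /and3P[_ vS _] ->.
have reach_driven j : strB M j ui != 0%R -> State j \notin S -> reach j.
  move=> Bj jS; apply: connect1; rewrite /remove_nodes jS /= Bj.
  by rewrite actuator_unattacked.
have reach_next j k :
    reach j -> Exx_neq M j k -> State k \notin S -> reach k.
  move=> rj /andP[Ajk _] kS; apply: (connect_trans rj); apply: connect1.
  by rewrite /remove_nodes kS reachS.
have type2S j : ~~ type1 M ui j -> State j \notin S.
  apply: contraNN; rewrite mem_attacked_state => /exists_inP[k].
  by rewrite in_setD1 => /andP[kui _] Bk; apply/type1P; exists k.
(* Otherwise the path to [State j] would continue through [Sensor i] to the sink. *)
have sensor_attacked j i : reach j -> strC M i j != 0%R -> i \in Ya.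
  move=> rj Cij; apply: contraNT sep => iY.
  apply: (connect_trans rj); apply: (@connect_trans _ _ (Sensor i)).
    apply: connect1.
    by rewrite /remove_nodes reachS //= Cij mem_attacked_sensor iY.
  apply: connect1.
  by rewrite /remove_nodes mem_attacked_sensor iY sink_unattacked.
have sensor_fin j : reach j -> sensor_weight M j != +oo%E.
  move=> rj; rewrite /sensor_weight ifF //; apply/exists_inP => -[i].
  by rewrite inE => Cij; apply/negP/unprot/(sensor_attacked j).
(* With the entry nodes of attacked states inside, no infinite edge into such a state is cut, only
   its edge of weight 1. *)
pose Vs := [set v : Gu_node M ui | match v with
  | GuSource => true
  | GuSink => false
  | GuIn x => reach (val x) || (State (val x) \in S)
  | GuOut x => reach (val x)
  | GuState x => reach (val x)
  end].
exists Vs; split; rewrite ?inE //.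
have fin p : cut_edge Vs p -> Gu_weight p.1 p.2 != +oo%E.
  case: p => -[||x|x|x] [||y|y|y] //; rewrite /cut_edge !inE //=.
  - by case/andP=> By /negP[]; apply: reach_driven By (type2S _ (valP y)).
  - by case/and3P=> _ + _; apply: sensor_fin.
  - case/and3P=> Axy rx /norP[ry yS]; case/negP: ry.
    exact: reach_next rx Axy yS.
  - case/and3P=> Axy rx /negP[].
    exact: reach_next rx Axy (type2S _ (valP y)).
  - by case/and3P=> _ + _; apply: sensor_fin.
  - case/and3P=> Axy rx /norP[ry yS]; case/negP: ry.
    exact: reach_next rx Axy yS.
  - case/and3P=> Axy rx /negP[].
    exact: reach_next rx Axy (type2S _ (valP y)).
rewrite cut_value_card // card_attack // -EFinD lee_fin.
rewrite -(PoszD _ 1) lez_nat addn1 ltnS; apply/subset_leq_card/subsetP => z.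
rewrite !inE => /existsP[[v w]] /andP[]; rewrite /cut_edge.
case: z v w => [k|i] [||x|x|x] [||y|y|y] //; rewrite !inE /=; last 2 first.
- by case/and3P=> _ rx _; apply: sensor_attacked.
- by case/and3P=> _ rx _; apply: sensor_attacked.
(* A cut entry-exit edge belongs to an attacked state, whose only driver other than [ui] must then
   lie in [Ua]. *)
case/and3P=> /eqP<- /orP[-> //|xS] _ /and3P[_ _ Bk].
move: xS; rewrite mem_attacked_state => /exists_inP[l lU Bl].
by rewrite (strB_col_uniq Bk Bl) -in_setD1.
Qed.

(** * From cuts to attacks *)

Lemma cut_separator (Vs : {set Gu_node M ui}) :
  GuSource \in Vs -> GuSink \notin Vs ->
  cut_value (@Gu_edge _ _ _ _ M ui) (@Gu_weight _ _ _ _ M ui) Vs != +oo%E ->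
  exists Ua Ya, robust_feasible M ui Ua Ya /\
    (((#|Ua| + #|Ya|)%N%:Z)%:E <=
     cut_value (@Gu_edge _ _ _ _ M ui) (@Gu_weight _ _ _ _ M ui) Vs + 1)%E.
Proof.
move=> sV tV cfin; have fin p := cut_finite (p := p) cfin.
have uncut v w : Gu_edge v w -> Gu_weight v w = +oo%E -> v \in Vs -> w \in Vs.
  move=> vw wt vV; apply/negPn/negP => wV.
  by have := fin (v, w); rewrite /cut_edge /= vw vV wV wt eqxx => /(_ isT).
have res_mem v w z : resource v w z -> Gu_edge v w -> v \in Vs -> w \notin Vs ->
    z \in cut_resources Vs.
  move=> vwz vw vV wV; rewrite inE; apply/existsP; exists (v, w).
  by rewrite vwz /cut_edge /= vw vV wV.
pose Ua := ui |: [set k | inl k \in cut_resources Vs].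
pose Ya := [set i | inr i \in cut_resources Vs].
(* No edge is charged to [ui], so adding it to [Ua] costs exactly one. *)
have UaE k : (k \in Ua :\ ui) = (inl k \in cut_resources Vs).
  rewrite !inE; case: eqP => //= ->; apply/esym/existsP => -[[v w]].
  by case: v w => [||x|x|x] [||y|y|y] /andP[] //= _; rewrite eqxx andbF.
exists Ua, Ya; split; last first.
  rewrite cut_value_card // card_attack ?setU11 // -EFinD lee_fin.
  rewrite -(PoszD _ 1) lez_nat addn1 ltnS; apply/subset_leq_card/subsetP.
  by case=> [k|i]; rewrite inE ?UaE // inE.
apply/and3P; split; first exact: setU11.
  (* A charged sensor lies on a cut edge of finite weight, so it is unprotected. *)
  apply/forall_inP => i; rewrite !inE => /existsP[[v w]] /andP[cvw].
  have := fin _ cvw; case: v w cvw => [||x|x|x] [||y|y|y] //= _;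
    rewrite /sensor_weight; case: ifPn => // /exists_inPn h _ Ci;
    by apply: h; rewrite inE.
apply/and4P; split; rewrite ?actuator_unattacked ?sink_unattacked //.
set S := attacked_nodes M ui Ua Ya.
pose is_exit (j : 'I_nx) (v : Gu_node M ui) := match v with
  | GuOut x => val x == j | GuState x => val x == j | _ => false end.
(* Invariant along unattacked paths from [ui]; it fails at the sink. *)
pose marked (v : Gt_node nx nu (ny + ne)) := match v with
  | Actuator k => k == ui
  | State j => [exists v in Vs, is_exit j v]
  | Sensor i => [exists j, (strC M i j != 0%R) && [exists v in Vs, is_exit j v]]
  | Sink => false
  end.
have step v w : marked v -> remove_nodes (Gt_edge M) S v w -> marked w.
  move=> mv /and3P[vS wS vw]; case: v w vS wS vw mv => [j|k|i|] [l|m|n|] //=.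
  - move=> _ lS Alj /exists_inP[v vV vj].
    (* Self-loops have no counterpart in the weighted graph and are treated apart. *)
    have [<-|jl] := eqVneq j l; first by apply/exists_inP; exists v.
    have Exx : Exx_neq M j l by rewrite /Exx_neq /= Alj.
    case: (boolP (type1 M ui l)) => tl; last first.
      pose w : Gu_node M ui := GuState (exist _ l tl).
      apply/exists_inP; exists w; rewrite /= ?eqxx //.
      by apply: uncut vV; case: v vj => //= x /eqP->.
    pose y : {j | type1 M ui j} := exist _ l tl.
    have inV : GuIn y \in Vs.
      by apply: uncut vV; case: v vj => //= x /eqP->.
    apply/exists_inP; exists (GuOut y); rewrite /= ?eqxx //.
    (* If the exit node were outside, the entry-exit edge would be cut and the driver of [l]
       attacked. *)
    apply: contraNT lS => outV; rewrite mem_attacked_state.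
    have /type1P[k kui Bk] := tl.
    apply/exists_inP; exists k => //; rewrite UaE.
    by apply: (res_mem (GuIn y) (GuOut y)); rewrite /= ?eqxx ?kui.
  - by move=> _ _ Cnj jV; apply/existsP; exists j; rewrite Cnj.
  - move=> _ lS Bl /eqP kui; rewrite kui in Bl.
    apply/exists_inP; exists (GuState (exist _ l (driven_type2 Bl)));
      rewrite /= ?eqxx //.
    exact: uncut sV.
  (* The edge from the exit node of [j] to the sink is cut, so [i] is charged, against [iS]. *)
  - move=> iS _ _ /existsP[j /andP[Cij /exists_inP[v vV vj]]].
    case/negP: iS; rewrite mem_attacked_sensor inE.
    have nonempty : measuring_sensors M j != set0.
      by apply/set0Pn; exists i; rewrite inE.
    by apply: (res_mem v GuSink) => //; case: v vj {vV} => //= x /eqP->.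
apply/connectP => -[p pth sink].
have : marked (Actuator ui) by rewrite /= eqxx.
elim: p (Actuator ui) pth sink => [|w p IH] v /=; first by move=> _ <-.
by case/andP=> vw pth sink mv; apply: IH pth sink _; apply: step vw.
Qed.

End StructuralModel.

Theorem proposition3 (nx nu ny ne : nat) (M : structural_model nx nu ny ne)
    (ui : 'I_nu) :
  let delta_r := robust_security_index M ui in
  let delta_star :=
    min_cut (@Gu_edge nx nu ny ne M ui) (@Gu_weight nx nu ny ne M ui)
      GuSource GuSink in
  (robust_solvable M ui -> delta_r = (delta_star + 1)%E) /\
  (~ robust_solvable M ui -> delta_r = +oo%E /\ delta_star = +oo%E).
Proof.
move=> delta_r delta_star.
have eq_delta : delta_r = (delta_star + 1)%E.
  apply/eqP; rewrite eq_le; apply/andP; split.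
    (* Moving the finite 1 to the left leaves a bare minimum, to be bounded cut by cut. *)
    rewrite -leeBlDr //; apply: le_bigmin; first exact: leey.
    move=> Vs /andP[sV tV]; rewrite leeBlDr //.
    set c := cut_value _ _ Vs.
    have [->|cfin] := eqVneq c +oo%E; first exact: leey.
    have [Ua [Ya [feas]]] := cut_separator sV tV cfin; apply: le_trans.
    exact: (bigmin_le_cond _ _ (j := (Ua, Ya))).
  apply: le_bigmin => [|[Ua Ya] /= feas]; first exact: leey.
  have [Vs [sV tV]] := separator_cut feas; apply: le_trans.
  by apply: leeD2r; apply: bigmin_le_cond; rewrite sV.
split=> // unsolvable.
have r_oo : delta_r = +oo%E.
  rewrite /delta_r /robust_security_index big_pred0 // => -[Ua Ya].
  by apply/negP => feas; case: unsolvable; exists Ua, Ya.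
(* Adding 1 reaches [+oo] only from [+oo]. *)
split=> //; move: eq_delta; rewrite r_oo.
by case: delta_star.
Qed.
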